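(* Let $d\ge 2$ and consider the function $$p\longmapsto \frac{\sum_{k=0}^{d-2}\overline{F}(k)}{-\sum_{j=1}^d p_j\log p_j}$$ on the set of probability vectors $p=(p_1,\dots,p_d)\in[0,1]^d$ with no entry equal to $1$, where $\overline{F}(k)=1-\sum_{j=1}^k p_j$. This function is minimized at $p=p^{\mathrm{bi}}$, given by $p^{\mathrm{bi}}_i=2^{-\min\{i,d-1\}}$ for $i\in\{1,\dots,d\}$. Furthermore, $$\frac{\sum_{k=0}^{d-2}\overline{F}(k)}{-\sum_{j=1}^d p_j\log p_j}\Big|_{p=p^{\mathrm{bi}}}=\frac{1}{\log 2},$$ and the function has no minima other than $p^{\mathrm{bi}}$.
   Context: $\log$ is the natural logarithm and $0\log 0=0$. *)

(* Defs.v *)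
From HB Require Import structures.
From mathcomp Require Import all_boot all_order all_algebra.
From mathcomp Require Import classical_sets reals exp.

Set Implicit Arguments.
Unset Strict Implicit.
Unset Printing Implicit Defensive.

Import Order.TTheory GRing.Theory Num.Theory.

Local Open Scope ring_scope.
Local Open Scope classical_set_scope.

(* A vector (p_1, ..., p_d) is a row vector p with p_j = p 0 (j - 1). *)

Definition prob_vectors (R : realType) (d : nat) : set 'rV[R]_d :=
  [set p | (forall j, 0 <= p 0 j <= 1) /\ \sum_(j < d) p 0 j = 1].

Definition no_unit_entry (R : realType) (d : nat) : set 'rV[R]_d :=
  [set p | prob_vectors p /\ forall j, p 0 j != 1].

(* Because of the index shift, the sum over 1 <= j <= k runs over the ordinals
   below k. *)
Definition Fbar (R : realType) (d : nat) (p : 'rV[R]_d) (k : nat) : R :=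
  1 - \sum_(j < d | (j < k)%N) p 0 j.

(* The convention 0 log 0 = 0 is automatic: ln is total and 0 * x = 0. *)
Definition entropy (R : realType) (d : nat) (p : 'rV[R]_d) : R :=
  - \sum_(j < d) p 0 j * ln (p 0 j).

Definition length_entropy_ratio (R : realType) (d : nat) (p : 'rV[R]_d) : R :=
  (\sum_(0 <= k < d.-1) Fbar p k) / entropy p.

Definition pbi (R : realType) (d : nat) : 'rV[R]_d :=
  \row_(i < d) 2 ^- minn i.+1 d.-1.

Definition is_minimizer (R : realType) (T : Type) (D : set T) (f : T -> R)
  (x : T) : Prop := D x /\ forall y, D y -> f x <= f y.

(* Main.v *)
Require Import Defs.
From mathcomp Require Import all_boot all_order all_algebra.
From mathcomp Require Import classical_sets reals sequences exp.
From mathcomp Require Import ring lra zify.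

(** The numerator is the expected length of a prefix code in which the symbol
    [i] (counted from 1) has a codeword of length [l_i = min i (d - 1)]:
    writing each tail [Fbar p k] as the sum of the [p_j] with [j > k] and
    exchanging the two sums gives [\sum_i p_i l_i] ([sum_Fbar]).  This code is
    complete, that is, [\sum_i 2 ^ - l_i = 1] ([sum_pbi]), so [pbi] is the
    probability vector with entries [2 ^ - l_i], and [ln 2] times the numerator
    is the cross entropy [- \sum_i p_i ln (pbi_i)].

    Gibbs' inequality ([gibbs_inequality]) bounds the entropy of [p] by this
    cross entropy, with equality only at [p = pbi].  Since the entropy is
    positive when no entry is 1 ([entropy_gt0]), division shows that the ratio
    is at least [1 / ln 2] and attains this value exactly at [pbi]
    ([length_entropy_ratio_leif]); the value at [pbi], its minimality and its
    uniqueness all follow.  Bounds are stated with [?= iff] throughout, so that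
    the equality case is carried along with each inequality. *)

Set Implicit Arguments.
Unset Strict Implicit.
Unset Printing Implicit Defensive.

Import Order.TTheory GRing.Theory Num.Theory.

Local Open Scope ring_scope.

(** The strict form of [1 + u < expR u] at [u = ln x], which is nonzero unless
    [x = 1]. *)
Lemma ln_leif_subr1 (R : realType) (x : R) : 0 < x ->
  ln x <= x - 1 ?= iff (x == 1).
Proof.
move=> x0; apply/leifP; case: eqVneq => [->|x1]; first by rewrite ln1 subrr.
have lnx : ln x != 0 by rewrite ln_eq0.
by have := expR_gt1Dx lnx; rewrite lnK ?posrE//; lra.
Qed.

(** The contribution of one entry to Gibbs' inequality.  For [x > 0] it is [x]
    times the tangent bound on the logarithm at [y / x].  The linear terms [x]
    and [y] cancel after summation over two vectors of equal mass; keeping them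
    makes the bound, and its equality case, hold entry by entry.  At [x = 0]
    both logarithmic terms vanish and [y > 0] makes the bound strict. *)
Lemma gibbs_term (R : realType) (x y : R) : 0 <= x -> 0 < y ->
  - (x * ln x) + x <= - (x * ln y) + y ?= iff (x == y).
Proof.
rewrite le_eqVlt => /predU1P[<- y0|x0 y0].
  by apply/leifP; rewrite !mul0r (lt_eqF y0); lra.
have yx0 : 0 < y / x by rewrite divr_gt0.
have -> : (x == y) = (y / x == 1).
  rewrite eq_sym -[in RHS](divff (lt0r_neq0 x0)).
  by rewrite (inj_eq (mulIf (invr_neq0 (lt0r_neq0 x0)))).
have yE : y = x * (y / x) by rewrite mulrC divfK ?gt_eqF.
have lnyE : ln y = ln (y / x) + ln x by rewrite -lnM ?posrE// divfK ?gt_eqF.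
have [le_ln eq_ln] := ln_leif_subr1 yx0; rewrite -eq_ln lnyE.
have -> : - (x * (ln (y / x) + ln x)) + y
        = - (x * ln x) + x + x * (y / x - 1 - ln (y / x)).
  by rewrite {2}yE; ring.
split; first by rewrite lerDl mulr_ge0 ?subr_ge0 ?(ltW x0).
rewrite eq_sym -subr_eq0 addrC addKr mulf_eq0 (gt_eqF x0) subr_eq0.
by rewrite eq_sym.
Qed.

Lemma gibbs_inequality (R : realType) (d : nat) (p q : 'rV[R]_d) :
    (forall j, 0 <= p 0 j) -> (forall j, 0 < q 0 j) ->
    \sum_(j < d) p 0 j = \sum_(j < d) q 0 j ->
  entropy p <= - \sum_(j < d) p 0 j * ln (q 0 j) ?= iff (p == q).
Proof.
move=> p0 q0 pq.
have /leif_sum H j : xpredT j ->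
    - (p 0 j * ln (p 0 j)) + p 0 j <= - (p 0 j * ln (q 0 j)) + q 0 j
      ?= iff (p 0 j == q 0 j).
  by move=> _; exact: gibbs_term.
move: H; rewrite !big_split /= !sumrN pq.
have -> : [forall j, p 0 j == q 0 j] = (p == q).
  by apply/eqfunP/eqP => [pqE|-> //]; apply/rowP => j; exact: pqE.
by move=> [le1 eq1]; split; [rewrite -(lerD2r (\sum_j q 0 j)) | rewrite -eq1 (inj_eq (addIr _))].
Qed.

(** If the entropy vanished, so would each of its nonnegative terms; with no
    entry equal to 1 this would force every entry to be 0, against total mass
    1. *)
Lemma entropy_gt0 (R : realType) (d : nat) (p : 'rV[R]_d) :
  no_unit_entry p -> 0 < entropy p.
Proof.
move=> [[p01 p1] pN1]; rewrite /entropy -sumrN lt0r.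
have t0 j : 0 <= - (p 0 j * ln (p 0 j)).
  by have /andP[? ?] := p01 j; rewrite -mulrN mulr_ge0// oppr_ge0 ln_le0.
apply/andP; split; last by apply: sumr_ge0 => j _; exact: t0.
apply/eqP => /psumr_eq0P-/(_ (fun j _ => t0 j)) z.
have/eqP := p1; rewrite big1 ?(eq_sym 0) ?oner_eq0// => j _.
have /andP[] := p01 j; rewrite le_eqVlt => /predU1P[//|pj0 pj1].
have /eqP := z j isT.
by rewrite oppr_eq0 mulf_eq0 (gt_eqF pj0) ln_eq0// (negbTE (pN1 j)).
Qed.

(** Tail-sum formula for the mean: [p_j] is counted by the tails [Fbar p k] with
    [k <= j], and [minn j.+1 n] of them have [k < n]. *)
Lemma sum_Fbar (R : realType) (d n : nat) (p : 'rV[R]_d) :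
    \sum_(j < d) p 0 j = 1 ->
  \sum_(0 <= k < n) Fbar p k = \sum_(j < d) p 0 j *+ minn j.+1 n.
Proof.
move=> p1; elim: n => [|n IH].
  by rewrite big_nil big1// => j _; rewrite minn0.
have FbarE : Fbar p n = \sum_(j < d) p 0 j *+ (n <= j).
  rewrite /Fbar -p1 [X in X - _](bigID (fun j : 'I_d => (j < n)%N)) /=.
  rewrite [LHS]addrC addKr big_mkcond /=; apply: eq_bigr => j _.
  by rewrite -leqNgt; case: leqP.
rewrite big_nat_recr//= IH FbarE -big_split /=; apply: eq_bigr => j _.
by rewrite -mulrnDr; congr (_ *+ _); case: leqP; lia.
Qed.

(** The Kraft sum of a binary tree that branches only along one spine: the last
    leaf is repeated at the depth of its sibling. *)
Lemma sum_halves (R : realType) (n : nat) :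
  \sum_(i < n) 2 ^- i.+1 + 2 ^- n = 1 :> R.
Proof.
elim: n => [|n IH]; first by rewrite big_ord0 expr0 invr1 add0r.
rewrite big_ord_recr /= -[RHS]IH -addrA; congr (_ + _).
by rewrite exprS invfM; field; rewrite expf_neq0 //= ?pnatr_eq0.
Qed.

Lemma sum_pbi (R : realType) (d : nat) : (2 <= d)%N ->
  \sum_(j < d) pbi R d 0 j = 1.
Proof.
case: d => [|[|n]]// _; rewrite big_ord_recr /= !mxE /=.
rewrite -[RHS](sum_halves R n.+1) (minn_idPr (leqnSn _)); congr (_ + _).
by apply: eq_bigr => i _; rewrite !mxE /= (minn_idPl (ltn_ord i)).
Qed.

Lemma pbi_gt0 (R : realType) (d : nat) j : 0 < pbi R d 0 j.
Proof. by rewrite mxE invr_gt0 exprn_gt0. Qed.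

Lemma pbi_lt1 (R : realType) (d : nat) j : (2 <= d)%N -> pbi R d 0 j < 1.
Proof.
move=> hd; rewrite mxE invf_lt1 ?exprn_gt0// exprn_egt1 ?ltr1n//.
by case: d hd j => [|[|d]] //= _ j; rewrite minnSS.
Qed.

Lemma no_unit_entry_pbi (R : realType) (d : nat) : (2 <= d)%N ->
  no_unit_entry (pbi R d).
Proof.
move=> hd; split; last by move=> j; rewrite lt_eqF ?pbi_lt1.
split; last exact: sum_pbi.
by move=> j; rewrite ltW ?pbi_gt0//= ltW ?pbi_lt1.
Qed.

Lemma ln_pbi (R : realType) (d : nat) (j : 'I_d) :
  ln (pbi R d 0 j) = - ln 2 *+ minn j.+1 d.-1.
Proof. by rewrite mxE lnV ?posrE ?exprn_gt0// lnXn// mulNrn. Qed.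

(** Gibbs' inequality against [pbi], whose cross entropy with [p] is [ln 2] times
    the expected length because [- ln (pbi_j)] is [ln 2] times the length of the
    [j]-th codeword. *)
Lemma entropy_leif (R : realType) (d : nat) (p : 'rV[R]_d) : (2 <= d)%N ->
    prob_vectors p ->
  entropy p <= ln 2 * \sum_(0 <= k < d.-1) Fbar p k ?= iff (p == pbi R d).
Proof.
move=> hd [p01 p1].
have -> : ln 2 * \sum_(0 <= k < d.-1) Fbar p k
        = - \sum_(j < d) p 0 j * ln (pbi R d 0 j).
  rewrite sum_Fbar// mulr_sumr -sumrN; apply: eq_bigr => j _.
  by rewrite ln_pbi mulNrn mulrN opprK !mulrnAr mulrC.
apply: gibbs_inequality; first by move=> j; have /andP[] := p01 j.
  exact: pbi_gt0.
by rewrite p1 sum_pbi.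
Qed.

Lemma length_entropy_ratio_leif (R : realType) (d : nat) (p : 'rV[R]_d) : (2 <= d)%N ->
    no_unit_entry p ->
  1 / ln 2 <= length_entropy_ratio p ?= iff (p == pbi R d).
Proof.
move=> hd pD; have H0 := entropy_gt0 pD.
have ln2 : 0 < ln 2 :> R by rewrite ln_gt0 ?ltr1n.
have [le eq] := entropy_leif hd pD.1.
rewrite /length_entropy_ratio; split.
  by rewrite ler_pdivrMr// mulrAC ler_pdivlMr// mul1r mulrC.
by rewrite eqr_div ?lt0r_neq0// mul1r mulrC.
Qed.

Theorem lemma2 (R : realType) (d : nat) (hd : (2 <= d)%N) :
  [/\ is_minimizer (@no_unit_entry R d) (@length_entropy_ratio R d) (pbi R d),
      length_entropy_ratio (pbi R d) = 1 / ln 2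
    & forall p : 'rV[R]_d,
        is_minimizer (@no_unit_entry R d) (@length_entropy_ratio R d) p -> p = pbi R d].
Proof.
have biD := no_unit_entry_pbi R hd.
have biE : length_entropy_ratio (pbi R d) = 1 / ln 2.
  by apply/esym/eqP; rewrite (length_entropy_ratio_leif hd biD).
split=> //; first by split=> // p /(length_entropy_ratio_leif hd)[]; rewrite biE.
move=> p [pD pmin]; apply/eqP; rewrite -(length_entropy_ratio_leif hd pD) eq_le.
by rewrite (length_entropy_ratio_leif hd pD) -biE pmin.
Qed.
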